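(* Every partial C*-algebra $A$ is, in the category $\mathbf{PCstar}$, the colimit of the diagram $\mathcal{C}(A)$ of its commutative C*-subalgebras (ordered by inclusion, with the inclusion maps as transition morphisms), the colimiting cocone being given by the inclusions $i_C\colon C\to A$ for $C\in\mathcal{C}(A)$. The same holds when $\mathcal{C}(A)$ is replaced by the diagram of finitely generated commutative C*-subalgebras of $A$.
   Context: C*-algebras are unital. A partial C*-algebra is a set $A$ with a reflexive and symmetric relation $\odot\subseteq A\times A$ (commeasurability), elements $0,1\in A$, a total involution $*\colon A\to A$, a total function $\cdot\colon\mathbb{C}\times A\to A$, a total function $\|-\|\colon A\to\mathbb{R}$, and partial binary operations $+,\cdot\colon\odot\to A$ (defined exactly on commeasurable pairs), such that every set $S\subseteq A$ of pairwise commeasurable elements is contained in a set $T\subseteq A$ whose elements are also pairwise commeasurable and on which the elements $0,1$ and the involution, scalar multiplication, norm, addition and multiplication of $A$ determine the structure of a commutative C*-algebra (so $T$ contains $0,1$, is closed under all algebraic operations, and is norm-complete). A partial *-morphism is a total function $f\colon A\to B$ between partial C*-algebras such that for commeasurable $a,b\in A$: $f(a)\odot f(b)$, $f(ab)=f(a)f(b)$, $f(a+b)=f(a)+f(b)$; and for all $z\in\mathbb{C}$, $a\in A$: $f(za)=zf(a)$, $f(a)^*=f(a^* )$; and $f(1)=1$. Partial C*-algebras and partial *-morphisms form the category $\mathbf{PCstar}$. A commutative (or commeasurable) C*-subalgebra of $A$ is a subset $T\subseteq A$ of pairwise commeasurable elements on which the operations of $A$ determine a commutative C*-algebra structure. $\mathcal{C}(A)$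 is the poset of these under inclusion. For a set $S\subseteq A$ of pairwise commeasurable elements, $A\langle S\rangle$ is the smallest commutative C*-subalgebra containing $S$; a commutative C*-subalgebra is finitely generated if it is of the form $A\langle S\rangle$ with $S$ finite.
   Formalization: The theorem additionally assumes that A⟨S⟩, the smallest commutative C*-subalgebra containing S, exists for every finite pairwise commeasurable S; this does not follow from the definition, and without it the claim fails (two copies of C[0,1] glued along the polynomials). *)

(* Defs.v *)
From HB Require Import structures.
From mathcomp Require Import all_boot all_order all_algebra.
From mathcomp Require Import boolp classical_sets cardinality reals.
From mathcomp Require Import complex.

Set Implicit Arguments.
Unset Strict Implicit.
Unset Printing Implicit Defensive.

Import Order.TTheory GRing.Theory Num.Theory.

Local Open Scope classical_set_scope.
Local Open Scope ring_scope.
Local Open Scope complex_scope.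

(* The reals are an arbitrary R : realType and the complex numbers are R[i]; the
   modulus is Normc.normc because the norm of R[i] takes its values in R[i]. *)

(* The zero algebra (zero = one) is allowed. The library's commutative algebra
   structures require 0 != 1 and total operations on a type, so the axioms are
   spelled out for explicit operations. *)
Record is_comm_cstar_algebra (R : realType) (X : Type)
    (zero one : X) (add mul : X -> X -> X)
    (star : X -> X) (scale : R[i] -> X -> X) (norm : X -> R) : Prop := {
  cs_addA : forall a b c, add a (add b c) = add (add a b) c ;
  cs_addC : forall a b, add a b = add b a ;
  cs_add0 : forall a, add zero a = a ;
  cs_addN : forall a, add a (scale (-1) a) = zero ;
  cs_scale1 : forall a, scale 1 a = a ;
  cs_scaleA : forall z w a, scale z (scale w a) = scale (z * w) a ;
  cs_scaleDr : forall z a b, scale z (add a b) = add (scale z a) (scale z b) ;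
  cs_scaleDl : forall z w a, scale (z + w) a = add (scale z a) (scale w a) ;
  cs_mulA : forall a b c, mul a (mul b c) = mul (mul a b) c ;
  cs_mulC : forall a b, mul a b = mul b a ;
  cs_mul1 : forall a, mul one a = a ;
  cs_mulDl : forall a b c, mul (add a b) c = add (mul a c) (mul b c) ;
  cs_scaleM : forall z a b, scale z (mul a b) = mul (scale z a) b ;
  cs_starK : forall a, star (star a) = a ;
  cs_starD : forall a b, star (add a b) = add (star a) (star b) ;
  cs_starM : forall a b, star (mul a b) = mul (star b) (star a) ;
  cs_starZ : forall z a, star (scale z a) = scale (conjc z) (star a) ;
  cs_norm_ge0 : forall a, 0 <= norm a ;
  cs_norm_eq0 : forall a, norm a = 0 -> a = zero ;
  cs_normD : forall a b, norm (add a b) <= norm a + norm b ;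
  cs_normZ : forall z a, norm (scale z a) = Normc.normc z * norm a ;
  cs_normM : forall a b, norm (mul a b) <= norm a * norm b ;
  cs_normC : forall a, norm (mul (star a) a) = norm a ^+ 2 ;
  cs_complete : forall u : nat -> X,
    (forall e : R, 0 < e -> exists N : nat, forall m n : nat,
       (N <= m)%N -> (N <= n)%N -> norm (add (u m) (scale (-1) (u n))) < e) ->
    exists l : X, forall e : R, 0 < e -> exists N : nat, forall n : nat,
       (N <= n)%N -> norm (add (u n) (scale (-1) l)) < e
}.

(* Only the data. A partial operation defined exactly on the relation [comm] is
   a function taking a proof of commeasurability as an argument; its value does
   not depend on the proof, by proof irrelevance. *)
Record partial_data (R : realType) := PartialData {
  carrier :> Type ;
  comm : carrier -> carrier -> Prop ;
  comm_refl : forall a, comm a a ;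
  comm_sym : forall a b, comm a b -> comm b a ;
  pzero : carrier ;
  pone : carrier ;
  pstar : carrier -> carrier ;
  pstarK : forall a, pstar (pstar a) = a ;
  pscale : R[i] -> carrier -> carrier ;
  pnorm : carrier -> R ;
  padd : forall a b, comm a b -> carrier ;
  pmul : forall a b, comm a b -> carrier
}.

Arguments pzero {R} p.
Arguments pone {R} p.

Definition pairwise_comm (R : realType) (A : partial_data R) (T : set A) : Prop :=
  forall a b, T a -> T b -> comm a b.

Record op_closed (R : realType) (A : partial_data R) (T : set A) : Prop := {
  closed0 : T (pzero A) ;
  closed1 : T (pone A) ;
  closed_star : forall a, T a -> T (pstar a) ;
  closed_scale : forall (z : R[i]) a, T a -> T (pscale z a) ;
  closed_add : forall a b (h : comm a b), T a -> T b -> T (padd h) ;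
  closed_mul : forall a b (h : comm a b), T a -> T b -> T (pmul h)
}.

Lemma sval_inj (X : Type) (T : set X) (x y : {a : X | T a}) :
  sval x = sval y -> x = y.
Proof. by case: x y => x hx [y hy] /= xy; exact: eq_exist. Qed.

Lemma sub_pstarK (R : realType) (A : partial_data R) (T : set A)
    (h : op_closed T) :
  let st (x : {a : A | T a}) :=
    exist T (pstar (sval x)) (closed_star h (svalP x)) in
  forall x, st (st x) = x.
Proof. by move=> st x; apply: sval_inj; rewrite /= pstarK. Qed.

Definition sub_partial_data (R : realType) (A : partial_data R) (T : set A)
    (h : op_closed T) : partial_data R :=
  @PartialData R {a : A | T a}
    (fun x y => comm (sval x) (sval y))
    (fun x => comm_refl (sval x))
    (fun x y => @comm_sym R A (sval x) (sval y))
    (exist T _ (closed0 h))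
    (exist T _ (closed1 h))
    (fun x => exist T _ (closed_star h (svalP x)))
    (sub_pstarK h)
    (fun z x => exist T _ (closed_scale h z (svalP x)))
    (fun x => pnorm (sval x))
    (fun x y c => exist T _ (closed_add h c (svalP x) (svalP y)))
    (fun x y c => exist T _ (closed_mul h c (svalP x) (svalP y))).

Definition total_comm_cstar (R : realType) (D : partial_data R)
    (tot : forall x y : D, comm x y) : Prop :=
  is_comm_cstar_algebra (pzero D) (pone D)
    (fun x y => padd (tot x y)) (fun x y => pmul (tot x y))
    (@pstar R D) (@pscale R D) (@pnorm R D).

Record is_comm_subalgebra (R : realType) (A : partial_data R) (T : set A)
    : Prop := {
  sa_comm : pairwise_comm T ;
  sa_closed : op_closed T ;
  sa_cstar : @total_comm_cstar R (sub_partial_data sa_closed)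
               (fun x y => sa_comm (svalP x) (svalP y))
}.

Record partial_cstar (R : realType) := PartialCstar {
  pc_data :> partial_data R ;
  pc_extend : forall S : set pc_data, pairwise_comm S ->
    exists2 T : set pc_data, S `<=` T & is_comm_subalgebra T
}.

Record is_partial_star_morphism (R : realType) (A B : partial_cstar R)
    (f : A -> B) : Prop := {
  pm_comm : forall a b, comm a b -> comm (f a) (f b) ;
  pm_mul : forall a b (h : comm a b), f (pmul h) = pmul (pm_comm h) ;
  pm_add : forall a b (h : comm a b), f (padd h) = padd (pm_comm h) ;
  pm_scale : forall (z : R[i]) a, f (pscale z a) = pscale z (f a) ;
  pm_star : forall a, pstar (f a) = f (pstar a) ;
  pm_one : f (pone A) = pone B
}.

Record partial_star_morphism (R : realType) (A B : partial_cstar R) := PStarMor {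
  pm_fun :> A -> B ;
  pm_prop : is_partial_star_morphism pm_fun
}.

Lemma pm_eq (R : realType) (A B : partial_cstar R)
    (f g : partial_star_morphism A B) : pm_fun f =1 pm_fun g -> f = g.
Proof.
case: f g => [f hf] [g hg] /= /funext fg; subst g.
by rewrite (Prop_irrelevance hf hg).
Qed.

Lemma pm_id_prop (R : realType) (A : partial_cstar R) :
  @is_partial_star_morphism R A A id.
Proof.
by exists (fun a b (h : comm a b) => h).
Qed.

Lemma pm_comp_prop (R : realType) (A B C : partial_cstar R)
    (g : partial_star_morphism B C) (f : partial_star_morphism A B) :
  @is_partial_star_morphism R A C (g \o f).
Proof.
case: g f => [g hg] [f hf].
exists (fun a b (h : comm a b) => pm_comm hg (pm_comm hf h)) => //=.
- by move=> a b h; rewrite (pm_mul hf) (pm_mul hg).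
- by move=> a b h; rewrite (pm_add hf) (pm_add hg).
- by move=> z a; rewrite (pm_scale hf) (pm_scale hg).
- by move=> a; rewrite (pm_star hg) (pm_star hf).
- by rewrite (pm_one hf) (pm_one hg).
Qed.

Record category := Category {
  obj :> Type ;
  hom : obj -> obj -> Type ;
  idm : forall X, hom X X ;
  compose : forall X Y Z, hom Y Z -> hom X Y -> hom X Z ;
  compose_idl : forall X Y (f : hom X Y), compose (idm Y) f = f ;
  compose_idr : forall X Y (f : hom X Y), compose f (idm X) = f ;
  composeA : forall X Y Z W (h : hom Z W) (g : hom Y Z) (f : hom X Y),
    compose h (compose g f) = compose (compose h g) f
}.

Record functor (J K : category) := Functor {
  fobj :> J -> K ;
  fmap : forall i j, hom i j -> hom (fobj i) (fobj j) ;
  fmap_id : forall i, fmap (idm i) = idm (fobj i) ;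
  fmap_comp : forall i j k (v : hom j k) (u : hom i j),
    fmap (compose v u) = compose (fmap v) (fmap u)
}.

Record cocone (J K : category) (F : functor J K) (X : K) := Cocone {
  leg : forall j, hom (F j) X ;
  leg_natural : forall i j (u : hom i j), compose (leg j) (fmap F u) = leg i
}.

Definition is_colimit (J K : category) (F : functor J K) (X : K)
    (c : cocone F X) : Prop :=
  forall (Y : K) (d : cocone F Y),
    exists! m : hom X Y, forall j, compose m (leg c j) = leg d j.

Definition PCstar (R : realType) : category :=
  @Category (partial_cstar R) (@partial_star_morphism R)
    (fun A => PStarMor (pm_id_prop A))
    (fun A B C g f => PStarMor (pm_comp_prop g f))
    (fun A B f => @pm_eq R A B (PStarMor (pm_comp_prop (PStarMor (pm_id_prop B)) f)) f
                    (fun a => erefl))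
    (fun A B f => @pm_eq R A B (PStarMor (pm_comp_prop f (PStarMor (pm_id_prop A)))) f
                    (fun a => erefl))
    (fun A B C D h g f => @pm_eq R A D
       (PStarMor (pm_comp_prop h (PStarMor (pm_comp_prop g f))))
       (PStarMor (pm_comp_prop (PStarMor (pm_comp_prop h g)) f))
       (fun a => erefl)).

Record comm_subalgebra (R : realType) (A : partial_cstar R) := CommSubalgebra {
  sa_set :> set A ;
  sa_prop : is_comm_subalgebra sa_set
}.

Definition sub_data (R : realType) (A : partial_cstar R)
    (C : comm_subalgebra A) : partial_data R :=
  sub_partial_data (sa_closed (sa_prop C)).

Lemma comm_cstar_transport (R : realType) (X Y : Type)
    (zX oX : X) (addX mulX : X -> X -> X) (starX : X -> X)
    (scaleX : R[i] -> X -> X) (normX : X -> R)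
    (zY oY : Y) (addY mulY : Y -> Y -> Y) (starY : Y -> Y)
    (scaleY : R[i] -> Y -> Y) (normY : Y -> R) (f : X -> Y) (g : Y -> X) :
  cancel f g -> cancel g f -> f zX = zY -> f oX = oY ->
  {morph f : x y / addX x y >-> addY x y} ->
  {morph f : x y / mulX x y >-> mulY x y} ->
  {morph f : x / starX x >-> starY x} ->
  (forall z, {morph f : x / scaleX z x >-> scaleY z x}) ->
  (forall x, normY (f x) = normX x) ->
  is_comm_cstar_algebra zY oY addY mulY starY scaleY normY ->
  is_comm_cstar_algebra zX oX addX mulX starX scaleX normX.
Proof.
move=> fK gK f0 f1 fD fM fS fZ fN [] H1 H2 H3 H4 H5 H6 H7 H8 H9 H10 H11 H12
  H13 H14 H15 H16 H17 H18 H19 H20 H21 H22 H23 H24.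
have fI := can_inj fK.
have nE x : normX x = normY (f x) by rewrite fN.
have fE := (f0, f1, fD, fM, fS, fZ).
split=> [a b c|a b|a|a|a|z w a|z a b|z w a|a b c|a b|a|a b c|z a b|a|a b|a b
        |z a|a|a|a b|z a|a b|a|u uC]; rewrite ?nE ?fE //;
  try by [apply: fI; rewrite !fE; auto | auto].
- by move=> a0; apply: fI; rewrite f0; apply: H19.
- have [e e0|l Hl] := H24 (f \o u).
    have [N HN] := uC e e0; exists N => m n mN nN /=.
    by rewrite -fZ -fD fN; exact: HN.
  exists (g l) => e /Hl[N HN]; exists N => n nN.
  by rewrite -fN fD fZ gK; exact: HN.
Qed.

Lemma sub_data_comm (R : realType) (A : partial_cstar R)
    (C : comm_subalgebra A) (x y : sub_data C) : comm x y.
Proof. exact: sa_comm (sa_prop C) _ _ (svalP x) (svalP y). Qed.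

Lemma sub_data_full (R : realType) (A : partial_cstar R)
  (C : comm_subalgebra A) : is_comm_subalgebra [set: sub_data C].
Proof.
have hc : pairwise_comm [set: sub_data C].
  by move=> x y _ _; exact: sub_data_comm.
have hcl : op_closed [set: sub_data C] by [].
exists hc hcl; rewrite /total_comm_cstar.
apply: (comm_cstar_transport (f := sval)
  (g := fun x : sub_data C => exist [set: sub_data C] x I))
  (sa_cstar (sa_prop C)) => //.
- by move=> x; apply: sval_inj.
- by move=> x y; apply: sval_inj; congr padd; exact: Prop_irrelevance.
- by move=> x y; apply: sval_inj; congr pmul; exact: Prop_irrelevance.
Qed.

Lemma sub_data_extend (R : realType) (A : partial_cstar R)
    (C : comm_subalgebra A) (S : set (sub_data C)) :
  pairwise_comm S ->
  exists2 T : set (sub_data C), S `<=` T & is_comm_subalgebra T.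
Proof. by move=> _; exists [set: sub_data C] => //; exact: sub_data_full. Qed.

(* A commutative C*-subalgebra, with the relation (here total) and the
   operations of A, as an object of PCstar. *)
Definition sub_object (R : realType) (A : partial_cstar R)
    (C : comm_subalgebra A) : partial_cstar R :=
  @PartialCstar R (sub_data C)
    (@sub_data_extend R A C).

Lemma incl_sub_prop (R : realType) (A : partial_cstar R)
    (C D : comm_subalgebra A) (CD : C `<=` D) :
  @is_partial_star_morphism R (sub_object C) (sub_object D)
    (fun x => exist (sa_set D) (sval x) (CD _ (svalP x))).
Proof.
exists (fun a b (h : @comm _ (sub_data C) a b) => h);
  by move=> *; exact: sval_inj.
Qed.

Definition incl_sub (R : realType) (A : partial_cstar R)
    (C D : comm_subalgebra A) (CD : C `<=` D) :
    hom (sub_object C : PCstar R) (sub_object D) :=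
  PStarMor (incl_sub_prop CD).

Lemma incl_prop (R : realType) (A : partial_cstar R) (C : comm_subalgebra A) :
  @is_partial_star_morphism R (sub_object C) A (fun x => sval x).
Proof. by exists (fun a b (h : @comm _ (sub_data C) a b) => h). Qed.

Definition incl (R : realType) (A : partial_cstar R) (C : comm_subalgebra A) :
    hom (sub_object C : PCstar R) (A : PCstar R) :=
  PStarMor (incl_prop C).

Lemma incl_sub_id (R : realType) (A : partial_cstar R)
    (C : comm_subalgebra A) (CC : C `<=` C) :
  incl_sub CC = idm (sub_object C : PCstar R).
Proof. by apply: pm_eq => x; exact: sval_inj. Qed.

Lemma incl_sub_comp (R : realType) (A : partial_cstar R)
    (C D E : comm_subalgebra A) (CE : C `<=` E) (DE : D `<=` E)
    (CD : C `<=` D) :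
  incl_sub CE = compose (incl_sub DE) (incl_sub CD).
Proof. by apply: pm_eq => x; exact: sval_inj. Qed.

Lemma incl_natural (R : realType) (A : partial_cstar R)
    (C D : comm_subalgebra A) (CD : C `<=` D) :
  compose (incl D) (incl_sub CD) = incl C.
Proof. exact: pm_eq. Qed.

(* The family s is injective in both uses below, so that this is the poset of
   its members ordered by inclusion, regarded as a category. *)
Definition inclusion_category (R : realType) (A : partial_cstar R) (I : Type)
    (s : I -> comm_subalgebra A) : category :=
  @Category I (fun i j => s i `<=` s j)
    (fun i => @subset_refl _ (s i))
    (fun i j k v u => subset_trans u v)
    (fun i j f => Prop_irrelevance _ _)
    (fun i j f => Prop_irrelevance _ _)
    (fun i j k l h g f => Prop_irrelevance _ _).

Definition inclusion_diagram (R : realType) (A : partial_cstar R) (I : Type)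
    (s : I -> comm_subalgebra A) :
    functor (inclusion_category s) (PCstar R) :=
  @Functor (inclusion_category s) (PCstar R)
    (fun i => sub_object (s i))
    (fun i j (u : s i `<=` s j) => incl_sub u)
    (fun i => incl_sub_id _)
    (fun i j k v u => incl_sub_comp _ _ _).

Definition inclusion_cocone (R : realType) (A : partial_cstar R) (I : Type)
    (s : I -> comm_subalgebra A) : cocone (inclusion_diagram s) A :=
  @Cocone (inclusion_category s) (PCstar R) (inclusion_diagram s) A
    (fun i => incl (s i)) (fun i j u => incl_natural _).

(* A<S> is the smallest commutative C*-subalgebra containing S; this is C = A<S>. *)
Definition is_generated_by (R : realType) (A : partial_cstar R)
    (S : set A) (C : comm_subalgebra A) : Prop :=
  S `<=` C /\ forall D : comm_subalgebra A, S `<=` D -> C `<=` D.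

(* A<S> exists for every finite set S of pairwise commeasurable elements. This
   does not follow from the axioms: the intersection of two commutative
   C*-subalgebras need not be complete, because a Cauchy sequence in it may have
   different limits in the two. *)
Definition has_generated_subalgebras (R : realType) (A : partial_cstar R)
    : Prop :=
  forall S : set A, finite_set S -> pairwise_comm S ->
    exists C : comm_subalgebra A, is_generated_by S C.

Definition finitely_generated (R : realType) (A : partial_cstar R)
    (C : comm_subalgebra A) : Prop :=
  exists S : set A,
    [/\ finite_set S, pairwise_comm S & is_generated_by S C].

Definition all_subalgebras (R : realType) (A : partial_cstar R) :
    comm_subalgebra A -> comm_subalgebra A := fun C => C.

Definition fg_subalgebras (R : realType) (A : partial_cstar R) :
    {C : comm_subalgebra A | finitely_generated C} -> comm_subalgebra A :=
  fun C => sval C.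

(* Main.v *)
Require Import Defs.
From mathcomp Require Import all_boot all_order all_algebra.
From mathcomp Require Import boolp classical_sets cardinality reals.
From mathcomp Require Import complex.

(** A family of commutative subalgebras has colimit [A] as soon as every
    commeasurable pair lies in a member and any two members sharing an element
    [a] contain a common member that contains [a]. By the second condition the
    legs of a cocone agree wherever they overlap, so they glue to one function
    on [A]; by the first, preservation of the partial operations can be checked
    inside a single member. For both diagrams of the theorem, the algebras
    generated by at most two elements provide the required members. *)

Set Implicit Arguments.
Unset Strict Implicit.
Unset Printing Implicit Defensive.

Local Open Scope classical_set_scope.

(** The type of [h] mentions [a] and [b], so they cannot be rewritten separately in [padd h]; proof
    irrelevance identifies the two proofs. *)
Lemma padd_congr (R : realType) (D : partial_data R) (a a' b b' : D)
    (h : comm a b) (h' : comm a' b') : a = a' -> b = b' -> padd h = padd h'.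
Proof. by move=> aa' bb'; subst a' b'; congr padd; exact: Prop_irrelevance. Qed.

Lemma pmul_congr (R : realType) (D : partial_data R) (a a' b b' : D)
    (h : comm a b) (h' : comm a' b') : a = a' -> b = b' -> pmul h = pmul h'.
Proof. by move=> aa' bb'; subst a' b'; congr pmul; exact: Prop_irrelevance. Qed.

Section ColimitOfSubalgebras.
Variables (R : realType) (A : partial_cstar R).
Variables (I : Type) (s : I -> comm_subalgebra A).
Hypothesis covers_pairs : forall a b : A, comm a b -> exists i, sa_set (s i) a /\ sa_set (s i) b.
Hypothesis meets_at : forall (a : A) i j, sa_set (s i) a -> sa_set (s j) a ->
  exists k, [/\ sa_set (s k) a, s k `<=` s i & s k `<=` s j].

Section Glue.
Variables (B : partial_cstar R).
Variable d : @cocone _ (PCstar R) (inclusion_diagram s) B.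

Let leg_at i (a : A) (h : sa_set (s i) a) : B := pm_fun (leg d i) (exist _ a h).

(** This is naturality of the cocone [d] along the inclusion [ij]. *)
Lemma leg_at_sub i j (ij : s i `<=` s j) (a : A) (hi : sa_set (s i) a) (hj : sa_set (s j) a) :
  leg_at hi = leg_at hj.
Proof.
rewrite /leg_at -(@leg_natural _ _ _ _ d i j ij) /=.
by congr (pm_fun (leg d j) _); exact: sval_inj.
Qed.

Lemma leg_at_agree i j (a : A) (hi : sa_set (s i) a) (hj : sa_set (s j) a) :
  leg_at hi = leg_at hj.
Proof.
have [k [hk ki kj]] := meets_at hi hj.
by rewrite -(leg_at_sub ki hk hi) (leg_at_sub kj hk hj).
Qed.

(** Choice turns the covering of the pair [(a, a)] into an index that [glue] can compute with;
    [glueE] shows that the choice is immaterial. *)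
Lemma member_containing (a : A) : {i | sa_set (s i) a}.
Proof.
by apply: cid; have [i []] := covers_pairs (comm_refl a); exists i.
Qed.

Definition glue (a : A) : B := leg_at (svalP (member_containing a)).

Lemma glueE i (a : A) (h : sa_set (s i) a) : glue a = pm_fun (leg d i) (exist _ a h).
Proof. exact: leg_at_agree. Qed.

Lemma glue_comm (a b : A) : comm a b -> comm (glue a) (glue b).
Proof.
move=> ab; have [i [ha hb]] := covers_pairs ab.
rewrite (glueE ha) (glueE hb).
exact: (pm_comm (pm_prop (leg d i))).
Qed.

Lemma glue_morphism : is_partial_star_morphism glue.
Proof.
exists glue_comm.
- move=> a b h; have [i [ha hb]] := covers_pairs h.
  have hi := closed_mul (sa_closed (sa_prop (s i))) h ha hb.
  have := pm_mul (pm_prop (leg d i))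
    (h : @comm _ (sub_data (s i)) (exist _ a ha) (exist _ b hb)).
  (* The product taken in [A], viewed as a point of the member, is the product taken in the member,
     so the leg preserves it. *)
  rewrite (glueE hi) (_ : exist _ _ hi = pmul
    (h : @comm _ (sub_data (s i)) (exist _ a ha) (exist _ b hb)));
    last exact: sval_inj.
  by move=> ->; apply: pmul_congr; rewrite ?(glueE ha) ?(glueE hb).
- move=> a b h; have [i [ha hb]] := covers_pairs h.
  have hi := closed_add (sa_closed (sa_prop (s i))) h ha hb.
  have := pm_add (pm_prop (leg d i))
    (h : @comm _ (sub_data (s i)) (exist _ a ha) (exist _ b hb)).
  rewrite (glueE hi) (_ : exist _ _ hi = padd
    (h : @comm _ (sub_data (s i)) (exist _ a ha) (exist _ b hb)));
    last exact: sval_inj.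
  by move=> ->; apply: padd_congr; rewrite ?(glueE ha) ?(glueE hb).
- move=> z a; have [i ha] := member_containing a.
  rewrite (glueE ha) -(pm_scale (pm_prop (leg d i))).
  (* The multiple taken in the member unfolds to [pscale z a] with its closure proof, so [glueE]
     applies up to conversion. *)
  exact: glueE.
- move=> a; have [i ha] := member_containing a.
  rewrite (glueE ha) (pm_star (pm_prop (leg d i))).
  by symmetry; exact: glueE.
- have [i h1] := member_containing (pone A).
  rewrite -(pm_one (pm_prop (leg d i))).
  exact: glueE.
Qed.

End Glue.

Lemma inclusion_cocone_colimit : is_colimit (inclusion_cocone s).
Proof.
move=> B d; exists (PStarMor (glue_morphism d)); split.
  by move=> i; apply: pm_eq => -[a ha] /=; exact: glueE.
move=> m hm; apply: pm_eq => a /=.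
(* Uniqueness: [hm] fixes [m] on each member, and the members cover [A]. *)
have [i ha] := member_containing a.
by rewrite (glueE d ha) -hm.
Qed.

End ColimitOfSubalgebras.

Theorem theorem15 (R : realType) (A : partial_cstar R)
    (hA : has_generated_subalgebras A) :
  is_colimit (inclusion_cocone (@all_subalgebras R A)) /\
  is_colimit (inclusion_cocone (@fg_subalgebras R A)).
Proof.
have gen2 (a b : A) : comm a b ->
    exists2 C, finitely_generated C & is_generated_by [set a; b] C.
  move=> ab.
  have fab : finite_set [set a; b] by exact: finite_set2.
  have cab : pairwise_comm [set a; b].
    by move=> x y [->|->] [->|->]; rewrite //; [exact: comm_refl|
      exact: comm_sym|exact: comm_refl].
  have [C hC] := hA _ fab cab.
  by exists C => //; exists [set a; b].
(* The algebra generated by [a] alone lies in every subalgebra containing [a], so it is the common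
   member sought inside two of them. *)
have gen1 (a : A) : exists C : comm_subalgebra A, [/\ finitely_generated C, sa_set C a &
    forall D : comm_subalgebra A, sa_set D a -> C `<=` D].
  have [C fC [CS Cmin]] := gen2 a a (comm_refl a).
  exists C; split=> //; first by apply: CS; left.
  by move=> D Da; apply: Cmin => _ [|] ->.
split; apply: inclusion_cocone_colimit.
- move=> a b /gen2[C _ [CS _]].
  by exists C; split; apply: CS; [left|right].
- move=> a C D Ca Da; have [E [_ Ea Emin]] := gen1 a.
  by exists E; split=> //; exact: Emin.
- move=> a b /gen2[C fC [CS _]].
  by exists (exist _ C fC); split; apply: CS; [left|right].
- move=> a C D Ca Da; have [E [fE Ea Emin]] := gen1 a.
  by exists (exist _ E fE); split=> //; exact: Emin.
Qed.
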